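(* Let $\Gamma_{\mathbb{Q}}=\bigwedge_{i=1}^{k_1}(x^{a_i}\in\mathbb{Q})\wedge\bigwedge_{j=1}^{k_2}(x^{b_j}\notin\mathbb{Q})$ be a system of rationality constraints (with $k_1,k_2\ge 0$ and all $a_i,b_j$ positive integers), and let $c\subseteq\mathbb{R}$ be a 1-cell. Then there exists a real algebraic number $\alpha\in c$ satisfying $\Gamma_{\mathbb{Q}}$ (i.e., $\alpha^{a_i}\in\mathbb{Q}$ for all $i$ and $\alpha^{b_j}\notin\mathbb{Q}$ for all $j$) if and only if there exists a positive integer $d$ satisfying $\mathcal{D}(\Gamma_{\mathbb{Q}})$, i.e., $d\mid a_i$ for all $i$ and $d\nmid b_j$ for all $j$.
   Context: A real algebraic number is a real root of a nonzero polynomial in $\mathbb{Z}[x]$. A 1-cell is a subset of $\mathbb{R}$ of one of the following forms, where $\alpha,\beta$ are real algebraic numbers: $(-\infty,\alpha)$ with $\alpha\le 0$; $(\alpha,\beta)$ with $0\le\alpha<\beta$ or $\alpha<\beta\le 0$; $(\alpha,+\infty)$ with $\alpha\ge 0$. The degree constraint system $\mathcal{D}(\Gamma_{\mathbb{Q}})$ associated with $\Gamma_{\mathbb{Q}}$ is the condition on a variable $d$ given by $\bigwedge_i (d\mid a_i)\wedge\bigwedge_j (d\nmid b_j)$. *)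

(* Defs.v *)
From mathcomp Require Import all_boot all_order all_algebra.
From mathcomp Require Import classical_sets set_interval reals.

Set Implicit Arguments.
Unset Strict Implicit.
Unset Printing Implicit Defensive.

Import Order.TTheory GRing.Theory Num.Theory.

Local Open Scope classical_set_scope.
Local Open Scope ring_scope.

(* [algebraicOver] asks for coefficients in a field, hence this version with
   integer coefficients. *)
Definition real_algebraic (R : realType) (x : R) : Prop :=
  exists2 p : {poly int}, p != 0 & root (map_poly (intr : int -> R) p) x.

Variant one_cell (R : realType) : set R -> Prop :=
  | OneCellLeft (alpha : R) :
      real_algebraic alpha -> alpha <= 0 ->
      one_cell `]-oo, alpha[
  | OneCellMid (alpha beta : R) :
      real_algebraic alpha -> real_algebraic beta ->
      0 <= alpha < beta \/ alpha < beta <= 0 ->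
      one_cell `]alpha, beta[
  | OneCellRight (alpha : R) :
      real_algebraic alpha -> 0 <= alpha ->
      one_cell `]alpha, +oo[.

(* The system stating that x ^ a_i is rational for all i, and x ^ b_j is
   irrational for all j, is represented by its two families of exponents. *)
Definition rationality_constraints (R : realType) (k1 k2 : nat)
    (a : 'I_k1 -> nat) (b : 'I_k2 -> nat) (x : R) : Prop :=
  (forall i, rational (x ^+ a i)) /\ (forall j, ~ rational (x ^+ b j)).

Definition degree_constraints (k1 k2 : nat)
    (a : 'I_k1 -> nat) (b : 'I_k2 -> nat) (d : nat) : Prop :=
  (forall i, (d %| a i)%N) /\ (forall j, ~~ (d %| b j)%N).

(* Main.v *)
Require Import Defs.
From mathcomp Require Import all_boot all_order all_algebra.
From mathcomp Require Import classical_sets set_interval reals.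

(** The exponents n for which x^n is rational, for x <> 0, are closed under gcd
    by Bezout's identity, so the gcd of the a_i satisfies the degree constraints
    (0 is in no 1-cell).  Conversely, given d, the 2-adic valuation shows that
    the n-th power of 2^(1/d) is rational only if d divides n; the nonzero
    rational multiples of 2^(1/d) share this property and are dense. *)

Set Implicit Arguments.
Unset Strict Implicit.
Unset Printing Implicit Defensive.

Import Order.TTheory GRing.Theory Num.Theory.

Local Open Scope ring_scope.

Lemma rational_ratr (R : realType) (q : rat) : rational (ratr q : R).
Proof. by exists q. Qed.

Lemma rational1 (R : realType) : rational (1 : R).
Proof. by rewrite -(rmorph1 (@ratr R)); apply: rational_ratr. Qed.

Lemma rationalX (R : realType) (x : R) n : rational x -> rational (x ^+ n).
Proof. by move=> [q _ <-]; rewrite -rmorphXn; apply: rational_ratr. Qed.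

Lemma rationalM (R : realType) (x y : R) :
  rational x -> rational y -> rational (x * y).
Proof.
by move=> [p _ <-] [q _ <-]; rewrite -rmorphM; apply: rational_ratr.
Qed.

Lemma rationalV (R : realType) (x : R) : rational x -> rational x^-1.
Proof. by move=> [q _ <-]; rewrite -fmorphV; apply: rational_ratr. Qed.

Lemma rational_expr_gcdn (R : realType) (x : R) m n : x != 0 ->
  rational (x ^+ m) -> rational (x ^+ n) -> rational (x ^+ gcdn m n).
Proof.
move=> x0 xm xn; have [->|m_gt0] := posnP m; first by rewrite gcd0n.
case: (egcdnP n m_gt0) => km kn bezout _.
(* Over the naturals Bezout reads [km * m = kn * n + gcdn m n]; the subtracted term becomes an
   inverse, which is where [x != 0] enters. *)
have -> : x ^+ gcdn m n = (x ^+ m) ^+ km * ((x ^+ n) ^+ kn)^-1.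
  rewrite -!exprM [(m * _)%N]mulnC [(n * _)%N]mulnC bezout exprD mulrAC divff ?mul1r//.
  by rewrite expf_neq0.
by apply: rationalM; [|apply: rationalV]; apply: rationalX.
Qed.

(** With r = p/q, comparing 2-adic valuations in p^e = 2 q^e gives e v(p) = 1 + e v(q), so e divides
    1. *)
Lemma expr_rat_eq2 (r : rat) e : r ^+ e = 2 -> e = 1%N.
Proof.
move=> re2; have den0 : ((denq r)%:Q ^+ e) != 0.
  by rewrite expf_neq0// intr_eq0 denq_neq0.
have : (numq r ^+ e = 2 * denq r ^+ e)%R.
  apply: (@intr_inj rat); rewrite rmorphM /= !rmorphXn /= -[2%:~R]/(2 : rat) -re2 -exprMn.
  by rewrite -{2}(divq_num_den r) divfK// intr_eq0 denq_neq0.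
move/(congr1 (logn 2 \o absz)); rewrite /= abszM !abszX lognM//; last first.
  by rewrite expn_gt0 absz_gt0 denq_neq0.
rewrite !lognX (@logn_prime 2 2)//= => eq_val.
have : (e %| 1)%N.
  by rewrite -(dvdn_addl _ (dvdn_mulr (logn 2 `|denq r|) (dvdnn e))) -eq_val dvdn_mulr.
by rewrite dvdn1 => /eqP.
Qed.

Lemma root2_exists (R : rcfType) d : (0 < d)%N ->
  exists2 t : R, 0 < t & t ^+ d = 2.
Proof.
move=> d_gt0; have [||t] := @poly_ivt R ('X^d - 2%:P) 0 2; first exact: ler0n.
  rewrite !hornerE expr0n eqn0Ngt d_gt0 sub0r oppr_le0 ler0n subr_ge0 /=.
  by rewrite ler_eXnr// ler1n.
move=> /andP[t_ge0 _]; rewrite rootE !hornerE subr_eq0 => /eqP td; exists t => //.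
rewrite lt_neqAle t_ge0 andbT; apply: contra_eq_neq td => <-.
by rewrite expr0n eqn0Ngt d_gt0 eq_sym pnatr_eq0.
Qed.

(** For g = gcd(d, n), t^g is a rational r with r^(d/g) = t^d = 2. Hence d/g = 1, so d = g divides
    n. *)
Lemma rational_root2X (R : realType) (t : R) d n :
  t ^+ d = 2 -> rational (t ^+ n) -> (d %| n)%N.
Proof.
move=> td tn; have [d0|d_gt0] := posnP d.
  by move: td; rewrite d0 expr0 => /eqP; rewrite eq_sym -subr_eq0 addrK oner_eq0.
have t0 : t != 0.
  by apply: contra_eq_neq td => ->; rewrite expr0n eqn0Ngt d_gt0 eq_sym pnatr_eq0.
have [|r _ rE] := rational_expr_gcdn t0 _ tn (m := d).
  by rewrite td -(rmorph_nat (@ratr R)); apply: rational_ratr.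
have /expr_rat_eq2 dg : r ^+ (d %/ gcdn d n) = 2.
  apply: (fmorph_inj (@ratr R)).
  by rewrite rmorphXn /= rE -exprM mulnC divnK ?dvdn_gcdl// td rmorph_nat.
by rewrite -(divnK (dvdn_gcdl d n)) dg mul1n dvdn_gcdr.
Qed.

Lemma rat_root_algebraic (R : realType) (x : R) d (q : rat) :
  (0 < d)%N -> x ^+ d = ratr q -> real_algebraic x.
Proof.
(* This is X^d - q with its denominator cleared; as d > 0, the constant term leaves the coefficient
   [denq q] of X^d intact, so the polynomial is nonzero. *)
move=> d_gt0 xd; exists (denq q *: 'X^d - (numq q)%:P).
  apply/eqP => /(congr1 (fun p : {poly int} => p`_d)).
  rewrite coefB coefZ coefXn eqxx mulr1 coefC eqn0Ngt d_gt0 subr0 coef0.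
  by apply/eqP; rewrite denq_neq0.
rewrite rootE rmorphB /= map_polyZ map_polyXn map_polyC /= !hornerE xd.
by rewrite /ratr mulrC divfK ?subrr// intr_eq0 denq_neq0.
Qed.

Lemma one_cell_neq0 (R : realType) (c : set R) (x : R) :
  one_cell c -> c x -> x != 0.
Proof.
case=> [u _ u0|u v _ _ uv|u _ u0]; rewrite /= in_itv /=.
- by move=> xu; rewrite lt_eqF// (lt_le_trans xu).
- move=> /andP[ux xv]; case: uv => /andP[].
    by move=> u0 _; rewrite gt_eqF// (le_lt_trans u0).
  by move=> _ v0; rewrite lt_eqF// (lt_le_trans xv).
- by rewrite andbT => ux; rewrite gt_eqF// (le_lt_trans u0).
Qed.

(** Reduces the three shapes of cell to one bounded open interval, where density of the rationals
    applies; unbounded cells are cut to length 1. *)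
Lemma one_cell_subitv (R : realType) (c : set R) : one_cell c ->
  exists u v : R, u < v /\ forall x, u < x < v -> c x.
Proof.
case=> [u _ _|u v _ _ uv|u _ _].
- exists (u - 1), u; split; first by rewrite ltrBlDr ltrDl.
  by move=> x /andP[_ xu]; rewrite /= in_itv.
- exists u, v; split; first by case: uv => /andP[].
  by move=> x uxv; rewrite /= in_itv.
- exists u, (u + 1); split; first by rewrite ltrDl.
  by move=> x /andP[ux _]; rewrite /= in_itv /= ux.
Qed.

Lemma one_cell_ratM (R : realType) (c : set R) (t : R) :
  one_cell c -> 0 < t -> exists q : rat, c (ratr q * t).
Proof.
move=> /one_cell_subitv[u [v [uv sub_c]]] t0.
(* Dividing the interval by t > 0 turns the search for a rational multiple of t into a search for a
   rational. *)
have [|q] := @rat_in_itvoo R (u / t) (v / t); first by rewrite ltr_pM2r ?invr_gt0.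
rewrite in_itv /= => /andP[uq qv]; exists q; apply: sub_c.
by rewrite -ltr_pdivrMr// uq -ltr_pdivlMr.
Qed.

Lemma degree_of_rationality (R : realType) k1 k2
    (a : 'I_k1 -> nat) (b : 'I_k2 -> nat) (x : R) :
    (forall i, (0 < a i)%N) -> (forall j, (0 < b j)%N) -> x != 0 ->
    rationality_constraints a b x ->
  exists d : nat, (0 < d)%N /\ degree_constraints a b d.
Proof.
move=> a_gt0 b_gt0 x0 [ax bx].
pose g := \big[gcdn/0]_i a i.
have g_dvd i : (g %| a i)%N by rewrite /g (bigD1 i)//= dvdn_gcdl.
(* The empty gcd is 0, for which x^0 = 1 is rational. *)
have gx : rational (x ^+ g).
  rewrite /g; elim/big_ind: _ => [|m n|i _]; first exact: rational1.
  - exact: rational_expr_gcdn.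
  - exact: ax.
have [g0|g_gt0] := posnP g; last first.
  exists g; split=> //; split=> // j; apply/negP => /dvdnP[k bE].
  by apply: (bx j); rewrite bE mulnC exprM; apply: rationalX.
(* Here there is no [a i], and any [d] exceeding all the [b j] will do. *)
exists (\sum_j b j).+1; split=> //; split=> [i|j].
  by move: (g_dvd i); rewrite g0 dvd0n eqn0Ngt a_gt0.
by rewrite gtnNdvd// ltnS (bigD1 j)//= leq_addr.
Qed.

Theorem theorem1 (R : realType) (k1 k2 : nat)
    (a : 'I_k1 -> nat) (b : 'I_k2 -> nat)
    (a_gt0 : forall i, (0 < a i)%N) (b_gt0 : forall j, (0 < b j)%N)
    (c : set R) (c_cell : one_cell c) :
  (exists alpha : R,
     [/\ real_algebraic alpha, c alpha & rationality_constraints a b alpha])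
  <-> (exists d : nat, (0 < d)%N /\ degree_constraints a b d).
Proof.
split=> [[x [_ cx xP]]|[d [d_gt0 [da db]]]].
  exact: degree_of_rationality a_gt0 b_gt0 (one_cell_neq0 c_cell cx) xP.
have [t t_gt0 td] := @root2_exists R d d_gt0.
have [q cqt] := one_cell_ratM c_cell t_gt0.
have q0 : ratr q != 0 :> R.
  by apply: contraNneq (one_cell_neq0 c_cell cqt) => ->; rewrite mul0r.
have qtd : (ratr q * t) ^+ d = ratr (q ^+ d * 2) :> R.
  by rewrite exprMn td rmorphM rmorphXn rmorph_nat.
exists (ratr q * t); split=> //; first exact: rat_root_algebraic d_gt0 qtd.
split=> [i|j].
  have /dvdnP[k ->] := da i.
  by rewrite mulnC exprM qtd; apply/rationalX/rational_ratr.
(* If (q t)^(b_j) were rational, dividing by q^(b_j) would make t^(b_j) rational, forcing d to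
   divide b_j. *)
move=> qtb; move: (db j); rewrite (rational_root2X td)//.
rewrite -[t](mulKf q0) exprMn; apply: rationalM => //.
by apply/rationalX/rationalV/rational_ratr.
Qed.
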